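(* In the setting of the context, with $\mathcal J_{\mathrm u}\neq\emptyset$, assume that the input-sharing graph $H=(\mathcal J_{\mathrm u},E)$ is a matching. Then the feasible set $$F=\{(u,v,x)\mid u\in\mathcal U,\ v=\bar Wu+\bar b,\ x=\mathrm{ReLU}(v)\}$$ of the reduced problem decomposes as the direct product $\prod_{e\in E}K_e\times\prod_{j\in\mathcal I}K_j$ of the local feasible sets of the single-edge and isolated-vertex components (by regrouping coordinates). Consequently, for every $\gamma\in\mathbb R$, $$\min_{(u,v,x)\in F}p_\gamma(u,v,x)=\eta_\gamma+\sum_{e\in E}m_e+\sum_{j\in\mathcal I}m_j .$$
   Context: **Setting.** $W\in\mathbb R^{n_1\times n_0}$, $b\in\mathbb R^{n_1}$, $A\in\mathbb R^{n_2\times n_1}$, $a,c\in\mathbb R^{n_2}$, nonempty box $\mathcal U=\{u\in\mathbb R^{n_0}\mid\underline u\le u\le\bar u\}$, $\mathrm{ReLU}(v)_j=\max\{v_j,0\}$. For each $j$ an interval $[\underline v_j,\overline v_j]$ containing $W_{j:}u+b_j$ for all $u\in\mathcal U$ is given; $\mathcal J^+=\{j\mid\underline v_j\ge0\}$, $\mathcal J_{\mathrm u}=\{j\mid\underline v_j<0<\overline v_j\}$. $\bar W=W_{\mathcal J_{\mathrm u},:}$, $\bar b=b_{\mathcal J_{\mathrm u}}$, $\bar A=A_{:,\mathcal J_{\mathrm u}}$, $\bar B=A_{:,\mathcal J^+}W_{\mathcal J^+,:}$, $\bar a=a+A_{:,\mathcal J^+}b_{\mathcal J^+}$; $v,x$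 are indexed by $\mathcal J_{\mathrm u}$. $p_\gamma(u,v,x)=\gamma-c^\top(\bar Ax+\bar Bu+\bar a)$, $\eta_\gamma=\gamma-c^\top\bar a$, $\alpha_j=(\bar A^\top c)_j$, $\delta_k=(\bar B^\top c)_k$. **Graph.** $S_j=\{k\mid\bar W_{jk}\neq0\}$; $\{i,j\}\in E$ iff $i\ne j$ and $S_i\cap S_j\ne\emptyset$. $H$ is a matching if all degrees are at most $1$. $\mathcal I$ is the set of degree-$0$ vertices. **Blocks.** With $\Lambda(k)=\{j\in\mathcal J_{\mathrm u}\mid k\in S_j\}$: $T_j=\{k\mid\Lambda(k)=\{j\}\}$, $T_e=\{k\mid\Lambda(k)=\{i,j\}\}$ for $e=\{i,j\}\in E$, $T_0=\{k\mid\Lambda(k)=\emptyset\}$. - For $j\in\mathcal I$: $\zeta_j=(u_{T_j},v_j,x_j)$; $\Theta_j^{\mathrm{lin}}(\zeta_j)=-\alpha_jx_j-\sum_{k\in T_j}\delta_ku_k$; $K_j$ is the set of $\zeta_j$ with $\underline u_k\le u_k\le\bar u_k$ ($k\in T_j$), $x_j\ge0$, $x_j-v_j\ge0$, $v_j=\bar W_{j,T_j}u_{T_j}+\bar b_j$, $x_j(x_j-v_j)=0$; $m_j=\min_{K_j}\Theta_j^{\mathrm{lin}}$. - For $e=\{i,j\}\in E$: $\zeta_e=(u_{T_i\cup T_e\cup T_j},v_i,x_i,v_j,x_j)$; $\Theta_e^{\mathrm{lin}}(\zeta_e)=-\alpha_ix_i-\alpha_jx_j-\sum_{k\in T_i\cup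 T_e\cup T_j}\delta_ku_k$; $K_e$ is the set of $\zeta_e$ with $\underline u_k\le u_k\le\bar u_k$ ($k\in T_i\cup T_e\cup T_j$) and, for $h=i,j$, $x_h\ge0$, $x_h-v_h\ge0$, $v_h=\bar W_{h,T_h}u_{T_h}+\bar W_{h,T_e}u_{T_e}+\bar b_h$, $x_h(x_h-v_h)=0$; $m_e=\min_{K_e}\Theta_e^{\mathrm{lin}}$. **Convention for $T_0$.** If $T_0\ne\emptyset$, one connected component $C^\circ$ of $H$ is fixed, and its block is enlarged: the variables $u_{T_0}$, the bounds $\underline u_k\le u_k\le\bar u_k$ ($k\in T_0$) and the objective term $-\sum_{k\in T_0}\delta_ku_k$ are added to its $\zeta$, its $K$ and its $\Theta^{\mathrm{lin}}$ respectively (and $m_{C^\circ}$ is the corresponding minimum). *)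

(* Defs.v *)
From HB Require Import structures.
From mathcomp Require Import all_boot all_order all_algebra.
From mathcomp Require Import boolp classical_sets reals.

Set Implicit Arguments.
Unset Strict Implicit.
Unset Printing Implicit Defensive.

Import Order.TTheory GRing.Theory Num.Theory.
Local Open Scope ring_scope.

Section Minimum.
Variable R : realType.

Definition is_min (S : set R) (m : R) : Prop := S m /\ lbound S m.

(* The value is meaningful only when a minimum exists (it is 0 otherwise). *)
Definition min_over (X : Type) (K : set X) (f : X -> R) : R :=
  xget 0 (is_min (f @` K)%classic).

Definition min_attained (X : Type) (K : set X) (f : X -> R) : Prop :=
  is_min (f @` K)%classic (min_over K f).

End Minimum.

Section Submatrices.
Variable R : realType.

(* For S a subset of 'I_m, the S-indexed objects are indexed by 'I_#|S|, the
   i-th position standing for the element [enum_val i] of S. *)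
Definition rows_of (m n : nat) (S : {set 'I_m}) (M : 'M[R]_(m, n)) :
  'M[R]_(#|S|, n) := rowsub (fun i : 'I_#|S| => enum_val i) M.

Definition cols_of (m n : nat) (S : {set 'I_n}) (M : 'M[R]_(m, n)) :
  'M[R]_(m, #|S|) := colsub (fun i : 'I_#|S| => enum_val i) M.

(* w_T u_T, for u indexed by D and T a subset of D. *)
Definition partial_dot (n : nat) (w : 'rV[R]_n) (D T : {set 'I_n})
  (u : 'cV[R]_#|D|) : R :=
  \sum_(k < #|D| | enum_val k \in T) w ord0 (enum_val k) * u k ord0.

Definition ReLU (m : nat) (v : 'cV[R]_m) : 'cV[R]_m :=
  map_mx (fun t => Num.max t 0) v.

Definition box (n : nat) (lo hi : 'cV[R]_n) : set 'cV[R]_n :=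
  fun u => forall k, lo k ord0 <= u k ord0 <= hi k ord0.

End Submatrices.

Record problem (R : realType) (n0 n1 n2 : nat) := Problem {
  W : 'M[R]_(n1, n0);
  b : 'cV[R]_n1;
  A : 'M[R]_(n2, n1);
  a : 'cV[R]_n2;
  c : 'cV[R]_n2;
  ulo : 'cV[R]_n0;
  uhi : 'cV[R]_n0;
  vlo : 'cV[R]_n1;
  vhi : 'cV[R]_n1
}.

Section Reduced.
Variables (R : realType) (n0 n1 n2 : nat) (P : problem R n0 n1 n2).

Definition U : set 'cV[R]_n0 := box (ulo P) (uhi P).

Definition valid_preactivation_bounds : Prop :=
  forall u, U u -> box (vlo P) (vhi P) (W P *m u + b P).

Definition Jplus : {set 'I_n1} := [set j | 0 <= vlo P j ord0]%SET.
Definition Ju : {set 'I_n1} :=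
  [set j | (vlo P j ord0 < 0) && (0 < vhi P j ord0)]%SET.

Definition Wbar : 'M[R]_(#|Ju|, n0) := rows_of Ju (W P).
Definition bbar : 'cV[R]_#|Ju| := rows_of Ju (b P).
Definition Abar : 'M[R]_(n2, #|Ju|) := cols_of Ju (A P).
Definition Bbar : 'M[R]_(n2, n0) := cols_of Jplus (A P) *m rows_of Jplus (W P).
Definition abar : 'cV[R]_n2 := a P + cols_of Jplus (A P) *m rows_of Jplus (b P).

Definition point : Type := ('cV[R]_n0 * 'cV[R]_#|Ju| * 'cV[R]_#|Ju|)%type.

Definition F : set point :=
  fun z => let: (u, v, x) := z in
    [/\ U u, v = Wbar *m u + bbar & x = ReLU v].

Definition objective (gamma : R) (z : point) : R :=
  let: (u, v, x) := z in
  gamma - ((c P)^T *m (Abar *m x + Bbar *m u + abar)) ord0 ord0.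

Definition eta (gamma : R) : R := gamma - ((c P)^T *m abar) ord0 ord0.
Definition alpha : 'cV[R]_#|Ju| := Abar^T *m c P.
Definition delta : 'cV[R]_n0 := Bbar^T *m c P.

End Reduced.

(* The vertices of the input-sharing graph are the elements of Ju, through
   their positions in the enumeration of Ju. *)
Notation vertex P := 'I_#|Ju P|.

Section Graph.
Variables (R : realType) (n0 n1 n2 : nat) (P : problem R n0 n1 n2).

Definition supp (j : vertex P) : {set 'I_n0} := [set k | Wbar P j k != 0]%SET.

Definition adj : rel (vertex P) :=
  fun i j => (i != j) && (supp i :&: supp j != finset.set0)%SET.

Definition edges : {set {set vertex P}} :=
  [set e | [exists i, exists j, adj i j && (e == [set i; j])]]%SET.

Definition degree (j : vertex P) : nat := #|[set i | adj j i]%SET|.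

Definition is_matching : Prop := forall j, (degree j <= 1)%N.

Definition isolated : {set vertex P} := [set j | degree j == 0%N]%SET.

Definition components : {set {set vertex P}} :=
  [set [set j | connect adj i j] | i : vertex P]%SET.

Definition Lambda (k : 'I_n0) : {set vertex P} := [set j | k \in supp j]%SET.

(* T_j, T_e and T_0 are [T P [set j]], [T P e] and [T P finset.set0]. *)
Definition T (C : {set vertex P}) : {set 'I_n0} := [set k | Lambda k == C]%SET.

End Graph.

Arguments T {R n0 n1 n2} P C.

(* C0 is the vertex set of the distinguished component carrying the inputs of
   T_0; when T_0 is empty it plays no role. *)
Section Blocks.
Variables (R : realType) (n0 n1 n2 : nat) (P : problem R n0 n1 n2).
Variable C0 : {set vertex P}.

Definition extra (C : {set vertex P}) : {set 'I_n0} :=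
  if C == C0 then T P finset.set0 else finset.set0.

Definition wdot (h : vertex P) (D Q : {set 'I_n0}) (u : 'cV[R]_#|D|) : R :=
  partial_dot (row h (Wbar P)) Q u.

(* - sum_{k in D} delta_k u_k *)
Definition input_cost (D : {set 'I_n0}) (u : 'cV[R]_#|D|) : R :=
  - \sum_(k < #|D|) delta P (enum_val k) ord0 * u k ord0.

Definition vert_inputs (j : vertex P) : {set 'I_n0} :=
  (T P [set j] :|: extra [set j])%SET.

Definition vert_point (j : vertex P) : Type :=
  ('cV[R]_#|vert_inputs j| * R * R)%type.

Definition K_vert (j : vertex P) : set (vert_point j) :=
  fun z => let: (u, v, x) := z in
    [/\ box (rows_of _ (ulo P)) (rows_of _ (uhi P)) u,
        0 <= x, 0 <= x - v,
        v = wdot j (T P [set j]%SET) u + bbar P j ord0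
      & x * (x - v) = 0].

Definition Theta_vert (j : vertex P) (z : vert_point j) : R :=
  let: (u, v, x) := z in - (alpha P j ord0 * x) + input_cost u.

Definition m_vert (j : vertex P) : R := min_over (@K_vert j) (@Theta_vert j).

(* For an edge e = {i, j} these are the inputs in T_i, T_e and T_j. *)
Definition edge_inputs (e : {set vertex P}) : {set 'I_n0} :=
  ((\bigcup_(h in e) T P [set h]) :|: T P e :|: extra e)%SET.

(* The v- and x-components are indexed by the endpoints of e. *)
Definition edge_point (e : {set vertex P}) : Type :=
  ('cV[R]_#|edge_inputs e| * 'cV[R]_#|e| * 'cV[R]_#|e|)%type.

Definition K_edge (e : {set vertex P}) : set (edge_point e) :=
  fun z => let: (u, v, x) := z in
    box (rows_of _ (ulo P)) (rows_of _ (uhi P)) u /\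
    forall i : 'I_#|e|, let h := enum_val i in
      [/\ 0 <= x i ord0, 0 <= x i ord0 - v i ord0,
          v i ord0 = wdot h (T P [set h]%SET) u + wdot h (T P e) u + bbar P h ord0
        & x i ord0 * (x i ord0 - v i ord0) = 0].

Definition Theta_edge (e : {set vertex P}) (z : edge_point e) : R :=
  let: (u, v, x) := z in
  - (\sum_(i < #|e|) alpha P (enum_val i) ord0 * x i ord0) + input_cost u.

Definition m_edge (e : {set vertex P}) : R :=
  min_over (@K_edge e) (@Theta_edge e).

Definition block_product_space : Type :=
  ((forall e : {e | e \in edges P}, edge_point (val e)) *
   (forall j : {j | j \in isolated P}, vert_point (val j)))%type.

Definition block_product : set block_product_space :=
  fun z => (forall e, @K_edge (val e) (z.1 e)) /\
           (forall j, @K_vert (val j) (z.2 j)).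

Definition regroup (z : point P) : block_product_space :=
  let: (u, v, x) := z in
  (fun e => (rows_of _ u, rows_of _ v, rows_of _ x),
   fun j => (rows_of _ u, v (val j) ord0, x (val j) ord0)).

End Blocks.

Arguments K_vert {R n0 n1 n2 P} C0 j _.
Arguments Theta_vert {R n0 n1 n2 P} C0 j _.
Arguments K_edge {R n0 n1 n2 P} C0 e _.
Arguments Theta_edge {R n0 n1 n2 P} C0 e _.
Arguments block_product {R n0 n1 n2 P} C0 _.
Arguments F {R n0 n1 n2} P _.
Arguments objective {R n0 n1 n2} P gamma _.

(* Main.v *)
(* In a matching every connected component is an isolated vertex or an edge, so
   Lambda(k) is empty or contained in a single component.  Each input therefore
   has exactly one home component (C0 for the inputs of T_0), which makes the
   regrouping of coordinates a bijection and turns the constraints and the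
   affine objective into block-by-block ones.  On each block v and x are
   continuous functions of u, so local minima exist by compactness of the box;
   gluing the local minimizers attains the sum of the local lower bounds. *)

From mathcomp Require Import all_boot all_order all_algebra.
From mathcomp Require Import boolp classical_sets reals.
From mathcomp Require Import topology normedtype derive ring.
Require Import Defs.
Import Order.TTheory GRing.Theory Num.Theory.
Import numFieldNormedType.Exports.
Local Open Scope ring_scope.

Set Implicit Arguments.
Unset Strict Implicit.
Unset Printing Implicit Defensive.

(** * Minima of real functions, and their attainment on images of boxes *)

Section Minimum.
Variable R : realType.

(** Antisymmetry of the order makes a minimum unique, so the value chosen by [xget] is forced. *)
Lemma min_over_unique (X : Type) (K : set X) (f : X -> R) m :
  is_min (f @` K)%classic m -> min_over K f = m.
Proof.
move=> [Km mK]; apply: xget_unique => // y [Ky yK].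
by apply/eqP; rewrite eq_le yK//= mK.
Qed.

Lemma min_attained_argmin (X : Type) (K : set X) (f : X -> R) z :
  K z -> (forall y, K y -> f z <= f y) -> min_attained K f /\ min_over K f = f z.
Proof.
move=> Kz zmin; have fz : is_min (f @` K)%classic (f z).
  by split; [exists z|move=> _ [y Ky <-]; exact: zmin].
by rewrite /min_attained (min_over_unique fz).
Qed.

Lemma argmin_exists (X : Type) (K : set X) (f : X -> R) :
  min_attained K f -> exists z, K z /\ f z = min_over K f.
Proof. by move=> [[z Kz fz] _]; exists z. Qed.

Lemma min_over_le (X : Type) (K : set X) (f : X -> R) z :
  min_attained K f -> K z -> min_over K f <= f z.
Proof. by move=> [_ lb] Kz; apply: lb; exists z. Qed.

(** The extreme value theorem, transported along [g]. Continuity is asked of the composite only, so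
    [X] carries no topology; the transpose passes to row vectors, for which compactness and the
    extreme value theorem are applied. *)
Lemma box_image_min_attained (X : Type) (K : set X) (f : X -> R) n
    (lo hi : 'cV[R]_n) (g : 'cV[R]_n -> X) :
  (box lo hi !=set0)%classic -> (K = g @` box lo hi)%classic ->
  continuous (fun r : 'rV[R]_n => f (g r^T)) ->
  min_attained K f.
Proof.
move=> [u0 bu0] -> cf.
pose I i : set R := `[lo i ord0, hi i ord0]%classic.
pose A : set 'rV[R]_n :=
  [set r : 'rV[R]_n | forall i, I i (r ord0 i)]%classic.
have AE r : A r <-> box lo hi r^T.
  by rewrite /A /I /box /=; split=> h k; move: (h k); rewrite mxE /= in_itv.
have cA : compact A.
  by apply: (@rV_compact _ _ I) => i; exact: segment_compact.
have A0 : (A !=set0)%classic by exists u0^T; apply/AE; rewrite trmxK.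
have [r rA rmin] := EVT_min_rV A0 cA (continuous_subspaceT (A := A) cf).
rewrite inE in rA.
apply: (proj1 (@min_attained_argmin _ _ _ (g r^T) _ _)).
  by exists r^T => //; apply/AE.
move=> _ [u bu <-]; rewrite -[u]trmxK; apply: rmin.
by rewrite inE; apply/AE; rewrite trmxK.
Qed.

Section Continuity.
Variable V : topologicalType.

Lemma continuous_sum (I : finType) (D : pred I) (f : I -> V -> R) :
  (forall i, continuous (f i)) -> continuous (fun r => \sum_(i | D i) f i r).
Proof.
move=> cf; apply: (continuous_big (@add_continuous R^o)) => i _.
exact: cf.
Qed.

Lemma continuous_mull (w : R) (f : V -> R) :
  continuous f -> continuous (fun r => w * f r).
Proof. by move=> cf r; apply: cvgM; [exact: cvg_cst|exact: cf]. Qed.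

Lemma continuous_add (f g : V -> R) :
  continuous f -> continuous g -> continuous (fun r => f r + g r).
Proof. by move=> cf cg r; apply: cvgD; [exact: cf|exact: cg]. Qed.

Lemma continuous_opp (f : V -> R) :
  continuous f -> continuous (fun r => - f r).
Proof. by move=> cf r; apply: cvgN; exact: cf. Qed.

Lemma continuous_max0 (f : V -> R) :
  continuous f -> continuous (fun r => Num.max (f r) 0).
Proof.
move=> cf r; apply: (@continuous_max _ _ (f : V -> R^o) (fun=> 0)).
  exact: cf.
exact: cvg_cst.
Qed.

End Continuity.

Lemma continuous_entry n (k : 'I_n) :
  continuous (fun r : 'rV[R]_n => r^T k ord0).
Proof.
rewrite (_ : (fun r : 'rV[R]_n => r^T k ord0) = (fun r => r ord0 k)).
  exact: coord_continuous.
by apply/funext => r; rewrite mxE.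
Qed.

(** A vanishing product kills one factor, and the sign condition on the other selects the
    corresponding branch of the maximum. *)
Lemma complementarity_max0 (v x : R) :
  [/\ 0 <= x, 0 <= x - v & x * (x - v) = 0] <-> x = Num.max v 0.
Proof.
split=> [[x0 xv /eqP]|->].
  rewrite mulf_eq0 subr_eq0 => /orP[] /eqP e; subst x.
    by rewrite max_r// -subr_ge0.
  by rewrite max_l.
by case: (leP v 0) => v0; rewrite ?subrr ?mul0r ?mulr0 ?sub0r ?oppr_ge0 ?(ltW v0).
Qed.

End Minimum.

(** * Reindexing by positions in a subset of the coordinates *)

Section Positions.
Variables (n : nat) (S : {set 'I_n}).

Lemma forall_enum_val (Q : 'I_n -> Prop) :
  (forall i : 'I_#|S|, Q (enum_val i)) <-> (forall k, k \in S -> Q k).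
Proof.
split=> [h k kS|h i]; last exact/h/enum_valP.
by rewrite -(enum_rankK_in kS kS); exact: h.
Qed.

Variable R : realType.

Lemma rows_ofE m (M : 'M[R]_(n, m)) i k : rows_of S M i k = M (enum_val i) k.
Proof. by rewrite mxE. Qed.

Lemma box_rows_of (lo hi u : 'cV[R]_n) :
  box (rows_of S lo) (rows_of S hi) (rows_of S u) <->
  forall k, k \in S -> lo k ord0 <= u k ord0 <= hi k ord0.
Proof.
rewrite -forall_enum_val.
by split=> h i; move: (h i); rewrite !rows_ofE.
Qed.

Lemma sum_rows_of (w : 'I_n -> R) (u : 'cV[R]_n) :
  \sum_(i < #|S|) w (enum_val i) * rows_of S u i ord0 =
  \sum_(k in S) w k * u k ord0.
Proof.
by rewrite [RHS]big_enum_val; apply: eq_bigr => i _; rewrite rows_ofE.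
Qed.

Lemma partial_dot_rows_of (w : 'rV[R]_n) (Q : {set 'I_n}) (u : 'cV[R]_n) :
  Q \subset S ->
  partial_dot w Q (rows_of S u) = \sum_(k in Q) w ord0 k * u k ord0.
Proof.
move=> QS; rewrite /partial_dot.
transitivity (\sum_(k in S | k \in Q) w ord0 k * u k ord0).
  by rewrite [RHS]big_enum_val_cond; apply: eq_bigr => i _; rewrite rows_ofE.
apply: eq_bigl => k.
by case: (boolP (k \in Q)) => [/(fintype.subsetP QS)->|]; rewrite ?andbF.
Qed.

End Positions.

(** * Gluing a vector from subvectors *)

Section Gluing.
Variables (R : realType) (n : nat) (I : Type) (D : I -> {set 'I_n}).

Lemma rows_of_inj (u u' : 'cV[R]_n) :
  (forall k, exists i, k \in D i) ->
  (forall i, rows_of (D i) u = rows_of (D i) u') -> u = u'.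
Proof.
move=> covD eqD; apply/matrixP => k j; rewrite (ord1 j).
have [i] := covD k; move: k; apply/forall_enum_val => k.
by rewrite -!rows_ofE eqD.
Qed.

(** By disjointness a coordinate has at most one owner, hence at most one prescribed value.
    Coordinates outside every [D i] receive the default 0. *)
Lemma rows_of_glue (w : forall i, 'cV[R]_#|D i|) :
  (forall k i i', k \in D i -> k \in D i' -> i = i') ->
  exists u : 'cV[R]_n, forall i, rows_of (D i) u = w i.
Proof.
move=> disjD.
pose V k : set R := fun r => exists i (p : 'I_#|D i|),
  enum_val p = k /\ r = w i p ord0.
exists (\col_k xget 0 (V k)) => i; apply/matrixP => p j.
rewrite (ord1 j) rows_ofE mxE; apply: xget_unique; first by exists i, p.
move=> r [i' [p' [pp' ->]]].
have ii' : i' = i.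
  by apply: (disjD (enum_val p)); [rewrite -pp'|]; apply: enum_valP.
(* Eliminating the equality of owners puts [p] and [p'] in the same type of positions, where
   [enum_val] is injective. *)
by case: _ / ii' p pp' => p /enum_val_inj ->.
Qed.

End Gluing.

(** * The input-sharing graph when it is a matching *)

Section Graph.
Variables (R : realType) (n0 n1 n2 : nat) (P : problem R n0 n1 n2).
Hypothesis matching : is_matching P.

(* Under [matching], the connected component of [j] (see [connect_block]). *)
Definition block (j : vertex P) : {set vertex P} :=
  (j |: [set i | adj j i])%SET.

Lemma adjC (i j : vertex P) : adj i j = adj j i.
Proof. by rewrite /adj eq_sym finset.setIC. Qed.

Lemma adj_unique (i j k : vertex P) : adj i j -> adj i k -> j = k.
Proof.
move=> ij ik; have /card_le1_eqP := matching i.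
by apply; rewrite inE.
Qed.

Lemma mem_block (j : vertex P) : j \in block j.
Proof. by rewrite !inE eqxx. Qed.

Lemma block_adj (i j : vertex P) : adj i j -> block i = [set i; j]%SET.
Proof.
move=> ij; apply/setP => k; rewrite !inE.
have [->|kj] /= := eqVneq k j; first by rewrite ij.
by case: (boolP (adj i k)) kj => // /(adj_unique ij)->; rewrite eqxx.
Qed.

Lemma block_isolated (j : vertex P) : j \in isolated P -> block j = [set j]%SET.
Proof. by rewrite inE cards_eq0 /block => /eqP ->; rewrite finset.setU0. Qed.

Lemma edgeP (e : {set vertex P}) :
  reflect (exists i j, adj i j /\ e = [set i; j]%SET) (e \in edges P).
Proof.
rewrite inE; apply: (iffP existsP) => [[i /existsP[j /andP[ij /eqP ->]]]|].
  by exists i, j.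
by move=> [i [j [ij ->]]]; exists i; apply/existsP; exists j; rewrite ij eqxx.
Qed.

Lemma block_edge (j : vertex P) : j \notin isolated P -> block j \in edges P.
Proof.
rewrite inE cards_eq0 => /finset.set0Pn[i]; rewrite inE => ji.
by apply/edgeP; exists j, i; rewrite (block_adj ji).
Qed.

(** Each endpoint of an edge has the other endpoint as its only neighbour. *)
Lemma block_eq_edge (e : {set vertex P}) (j : vertex P) : e \in edges P ->
  (block j == e) = (j \in e).
Proof.
move=> eE; apply/eqP/idP => [<-|]; first exact: mem_block.
move: eE => /edgeP[i [k [ik ->]]]; rewrite !inE => /orP[] /eqP ->.
  exact: block_adj.
by rewrite (@block_adj k i) 1?adjC// finset.setUC.
Qed.

Lemma block_eq1 (i j : vertex P) : j \in isolated P ->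
  (block i == [set j]%SET) = (i == j).
Proof.
move=> jI; apply/eqP/eqP => [|->]; last exact: block_isolated.
by move=> h; apply/set1P; rewrite -h mem_block.
Qed.

Lemma edge_neq1 (e : {set vertex P}) (j : vertex P) : e \in edges P ->
  e != [set j]%SET.
Proof.
move=> /edgeP[i [k [/andP[ik _] ->]]]; apply/eqP => ikj.
by have := cards2 i k; rewrite ikj cards1 ik.
Qed.

(** Paths from [i] cannot leave [block i]: a neighbour of [i] has no neighbour other than [i]
    itself, so the block is closed under adjacency. *)
Lemma connect_block (i j : vertex P) :
  connect (@adj _ _ _ _ P) i j = (j \in block i).
Proof.
apply/idP/idP => [ij|]; last first.
  by rewrite !inE => /orP[/eqP->|/connect1//]; exact: connect0.
have clB : fingraph.closed (@adj _ _ _ _ P) (mem (block i)).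
  apply: intro_closed => [x y|x y xy]; first by rewrite (sym_connect_sym adjC).
  rewrite !inE => /orP[/eqP xi|ix]; first by rewrite -xi xy orbT.
  by rewrite (adj_unique xy (k := i)) ?eqxx// adjC.
by rewrite -(closed_connect clB ij) mem_block.
Qed.

Lemma components_block (C : {set vertex P}) : C \in components P ->
  exists i, C = block i.
Proof.
move=> /imsetP[i _ ->]; exists i; apply/setP => j.
by rewrite inE connect_block.
Qed.

(** Two vertices that both read the input [k] have it in common in their supports, so they are equal
    or adjacent. *)
Lemma Lambda_block (k : 'I_n0) (j : vertex P) :
  j \in Lambda P k -> Lambda P k \subset block j.
Proof.
rewrite inE => kj; apply/fintype.subsetP => i; rewrite !inE => ki.
have [//|ij] := eqVneq i j; rewrite /adj eq_sym ij /=.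
by apply/finset.set0Pn; exists k; rewrite !inE in kj ki *; rewrite kj.
Qed.

Lemma Lambda_isolated (k : 'I_n0) (j : vertex P) : j \in isolated P ->
  j \in Lambda P k -> Lambda P k = [set j]%SET.
Proof.
move=> jI jk; apply/eqP; rewrite finset.eqEsubset finset.sub1set jk andbT.
by rewrite -(block_isolated jI) Lambda_block.
Qed.

(** By [Lambda_block] this set lies inside the two-element set [e]; if the inclusion is proper, only
    [j] is left. *)
Lemma Lambda_edge (e : {set vertex P}) (k : 'I_n0) (j : vertex P) :
  e \in edges P -> j \in e -> j \in Lambda P k ->
  Lambda P k = [set j]%SET \/ Lambda P k = e.
Proof.
move=> eE je jk; have := Lambda_block jk.
have /eqP-> : block j == e by rewrite block_eq_edge.
move=> sub; have [<-|ne] := eqVneq (Lambda P k) e; first by right.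
left; apply/eqP; rewrite eq_sym eqEcard finset.sub1set jk cards1.
have pr : Lambda P k \proper e by rewrite finset.properEneq ne.
have := proper_card pr; case/edgeP: eE => i [l [/andP[il _] ->]].
by rewrite cards2 il.
Qed.

End Graph.

(** * Existence of the local minima *)

Section BlockMinima.
Variables (R : realType) (n0 n1 n2 : nat) (P : problem R n0 n1 n2).
Variable C0 : {set vertex P}.
Hypothesis U_nonempty : (U P !=set0)%classic.

Lemma box_rows_of_nonempty (D : {set 'I_n0}) :
  (box (rows_of D (ulo P)) (rows_of D (uhi P)) !=set0)%classic.
Proof.
have [u Uu] := U_nonempty; exists (rows_of D u).
by apply/box_rows_of => k _; exact: Uu.
Qed.

Lemma continuous_wdot (h : vertex P) (D Q : {set 'I_n0}) :
  continuous (fun r : 'rV[R]_#|D| => wdot h Q r^T).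
Proof.
apply: continuous_sum => k; apply: continuous_mull.
exact: continuous_entry.
Qed.

Lemma continuous_input_cost (D : {set 'I_n0}) :
  continuous (fun r : 'rV[R]_#|D| => input_cost P r^T).
Proof.
apply: continuous_opp; apply: continuous_sum => k; apply: continuous_mull.
exact: continuous_entry.
Qed.

(** Complementarity turns [K_vert] into a graph over the box: [v] is affine in [u] and [x] is the
    positive part of [v], so the cost is a continuous function of [u]. *)
Lemma K_vert_min_attained (j : vertex P) :
  min_attained (K_vert C0 j) (Theta_vert C0 j).
Proof.
pose D := vert_inputs C0 j.
pose pre (u : 'cV[R]_#|D|) := wdot j (T P [set j]%SET) u + bbar P j ord0.
apply: (@box_image_min_attained _ _ _ _ _ _ _
  (fun u => (u, pre u, Num.max (pre u) 0)) (box_rows_of_nonempty D)).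
  apply/seteqP; split=> [[[u v] x] [bu x0 xv veq xc]|_ [u bu <-]].
    exists u => //; rewrite /pre -veq.
    by congr (_, _, _); apply/esym/complementarity_max0.
  by have /complementarity_max0[] := erefl (Num.max (pre u) 0).
have cpre : continuous (fun r : 'rV[R]_#|D| => pre r^T).
  by apply: continuous_add; [exact: continuous_wdot|exact: cst_continuous].
apply: continuous_add; last exact: continuous_input_cost.
by apply: continuous_opp; apply: continuous_mull; exact: continuous_max0.
Qed.

Lemma K_edge_min_attained (e : {set vertex P}) :
  min_attained (K_edge C0 e) (Theta_edge C0 e).
Proof.
pose D := edge_inputs C0 e.
pose pre (u : 'cV[R]_#|D|) (i : 'I_#|e|) := let h := enum_val i in
  wdot h (T P [set h]%SET) u + wdot h (T P e) u + bbar P h ord0.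
apply: (@box_image_min_attained _ _ _ _ _ _ _
  (fun u => (u, \col_i pre u i, \col_i Num.max (pre u i) 0))
  (box_rows_of_nonempty D)).
  apply/seteqP; split=> [[[u v] x] [bu h]|_ [u bu <-]].
    exists u => //; congr (_, _, _); apply/colP => i; rewrite mxE.
      by have [_ _ -> _] := h i.
    have [x0 xv veq xc] := h i; rewrite /pre -veq.
    by apply/esym/complementarity_max0.
  have colE (f : 'I_#|e| -> R) i : (\col_i f i) i ord0 = f i by rewrite mxE.
  split=> // i /=; rewrite !colE.
  by have /complementarity_max0[] := erefl (Num.max (pre u i) 0).
have cpre i : continuous (fun r : 'rV[R]_#|D| => pre r^T i).
  apply: continuous_add; last exact: cst_continuous.
  by apply: continuous_add; exact: continuous_wdot.
apply: continuous_add; last exact: continuous_input_cost.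
apply: continuous_opp; apply: continuous_sum => i; apply: continuous_mull.
under eq_fun do rewrite mxE.
exact: continuous_max0.
Qed.

End BlockMinima.

(** * Assigning vertices and inputs to blocks *)

Section Decomposition.
Variables (R : realType) (n0 n1 n2 : nat) (P : problem R n0 n1 n2).
Variable C0 : {set vertex P}.
Hypothesis matching : is_matching P.
Hypothesis C0_component : T P finset.set0 != finset.set0 -> C0 \in components P.

(* The vertex picked in [Lambda P k] is irrelevant by [Lambda_block]. *)
Definition home (k : 'I_n0) : {set vertex P} :=
  if [pick j in Lambda P k] is Some j then block j else C0.

Definition is_block (C : {set vertex P}) : Prop :=
  C \in edges P \/ exists2 j, j \in isolated P & C = [set j]%SET.

Lemma block_is_block (j : vertex P) : is_block (block j).
Proof.
have [jI|/(block_edge matching)] := boolP (j \in isolated P); last by left.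
by right; exists j => //; exact: block_isolated.
Qed.

Lemma home_is_block k : is_block (home k).
Proof.
rewrite /home; case: pickP => [j _|L0]; first exact: block_is_block.
(* No vertex reads [k], so [k] itself witnesses that $T_0$ is nonempty and the hypothesis on [C0]
   applies. *)
have : C0 \in components P.
  apply: C0_component; apply/finset.set0Pn; exists k; rewrite inE.
  by apply/eqP/setP => j; rewrite L0 inE.
move=> /(components_block matching)[i ->]; exact: block_is_block.
Qed.

Lemma mem_extra k (C : {set vertex P}) :
  (k \in extra C0 C) = (C == C0) && (Lambda P k == finset.set0).
Proof. by rewrite /extra; case: eqP => _; rewrite inE. Qed.

(** Rewriting the inputs of a block as a fibre of [home] makes covering and disjointness of the
    input sets immediate. *)
Lemma mem_vert_inputs k (j : vertex P) : j \in isolated P ->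
  (k \in vert_inputs C0 j) = (home k == [set j]%SET).
Proof.
move=> jI; rewrite inE mem_extra inE /home; case: pickP => [i ik|L0].
  rewrite block_eq1//; have -> : (Lambda P k == finset.set0) = false.
    by apply/eqP => L0; rewrite L0 inE in ik.
  rewrite andbF orbF; apply/eqP/eqP => [Lj|ij]; last first.
    by rewrite (Lambda_isolated jI)// -ij.
  by apply/set1P; rewrite -Lj.
have -> : Lambda P k = finset.set0 by apply/setP => j'; rewrite L0 inE.
(* An input read by no vertex cannot lie in $T_j$, so only the extra inputs of [C0] remain. *)
rewrite eqxx andbT [C0 == _]eq_sym orb_idl// => /eqP /setP /(_ j).
by rewrite !inE eqxx.
Qed.

Lemma mem_edge_inputs k (e : {set vertex P}) : e \in edges P ->
  (k \in edge_inputs C0 e) = (home k == e).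
Proof.
move=> eE; rewrite !inE mem_extra /home; case: pickP => [i ik|L0].
  rewrite block_eq_edge//; have -> : (Lambda P k == finset.set0) = false.
    by apply/eqP => L0; rewrite L0 inE in ik.
  rewrite andbF orbF; apply/orP/idP => [[/finset.bigcupP[h he]|/eqP <-//]|ie].
    by rewrite inE => /eqP Lh; move: ik; rewrite Lh => /set1P->.
  (* An input read by the endpoint [i] is either private to [i] or shared by the whole edge. *)
  have [Li|Le] := Lambda_edge matching eE ie ik; last by right; apply/eqP.
  by left; apply/finset.bigcupP; exists i => //; rewrite inE Li.
have L : Lambda P k = finset.set0 by apply/setP => j'; rewrite L0 inE.
rewrite L eqxx andbT [C0 == _]eq_sym orb_idl// => /orP[/finset.bigcupP[h he]|].
  by rewrite inE L => /eqP /setP /(_ h); rewrite !inE eqxx.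
case/edgeP: eE => i [j [ij ->]] /eqP /setP /(_ i).
by rewrite !inE eqxx.
Qed.

(** The sum is partitioned along the fibres of [h]. No edge is a singleton, so the two kinds of
    blocks do not overlap. *)
Lemma sum_by_block (I : finType) (h : I -> {set vertex P}) (f : I -> R) :
  (forall i, is_block (h i)) ->
  \sum_i f i = \sum_(e in edges P) \sum_(i | h i == e) f i
             + \sum_(j in isolated P) \sum_(i | h i == [set j]%SET) f i.
Proof.
move=> hb; pose S := [set [set j]%SET | j in isolated P]%SET.
rewrite (partition_big h [in [predU edges P & S]]) /=; last first.
  move=> i _; apply/orP.
  have [|[j jI ->]] := hb i; first by left.
  by right; apply/imsetP; exists j.
rewrite bigU; last first.
  rewrite disjoint_subset; apply/fintype.subsetP => C CE; rewrite inE.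
  by apply/imsetP => -[j _ Cj]; have := edge_neq1 j CE; rewrite Cj eqxx.
congr (_ + _); rewrite big_imset// => i j _ _; exact: finset.set1_inj.
Qed.

(** A nonzero weight at [k] puts [h] in [Lambda P k], hence [k] in exactly one of $T_h$ and $T_e$;
    zero weights add nothing to either side. The local inputs thus recover the full row product. *)
Lemma preactivation_edge (u : 'cV[R]_n0) (e : {set vertex P}) (h : vertex P) :
  e \in edges P -> h \in e ->
  wdot h (T P [set h]%SET) (rows_of (edge_inputs C0 e) u)
    + wdot h (T P e) (rows_of (edge_inputs C0 e) u)
  = (Wbar P *m u) h ord0.
Proof.
move=> eE he; rewrite /wdot !partial_dot_rows_of; last 2 first.
- by rewrite /edge_inputs -finset.setUA finset.setUC -finset.setUA finset.subsetUl.
- apply/fintype.subsetP => k kT; rewrite !inE; apply/orP; left; apply/orP; left.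
  by apply/finset.bigcupP; exists h.
rewrite big_mkcond [X in _ + X]big_mkcond -big_split /= mxE.
apply: eq_bigr => k _; rewrite !inE mxE.
have [->|nz] := eqVneq (Wbar P h k) 0; first by rewrite mul0r !if_same addr0.
have hk : h \in Lambda P k by rewrite !inE.
have [->|->] := Lambda_edge matching eE he hk.
  by rewrite eqxx eq_sym (negPf (edge_neq1 h eE)) addr0.
by rewrite eqxx (negPf (edge_neq1 h eE)) add0r.
Qed.

Lemma preactivation_vert (u : 'cV[R]_n0) (j : vertex P) : j \in isolated P ->
  wdot j (T P [set j]%SET) (rows_of (vert_inputs C0 j) u)
  = (Wbar P *m u) j ord0.
Proof.
move=> jI; rewrite /wdot partial_dot_rows_of; last exact: finset.subsetUl.
rewrite big_mkcond /= mxE; apply: eq_bigr => k _; rewrite inE mxE.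
have [->|nz] := eqVneq (Wbar P j k) 0; first by rewrite mul0r if_same.
by rewrite (Lambda_isolated jI) ?eqxx// !inE.
Qed.

(** * Regrouping of coordinates as a bijection *)

Definition block_index : Type :=
  ({e | e \in edges P} + {j | j \in isolated P})%type.

(** The vertex set labels a block of either kind, so that [mem_carrier] and [mem_inputs] describe
    all blocks uniformly as fibres of [block] and [home]. *)
Definition carrier (s : block_index) : {set vertex P} :=
  match s with inl e => val e | inr j => [set val j]%SET end.

Definition inputs (s : block_index) : {set 'I_n0} :=
  match s with
  | inl e => edge_inputs C0 (val e)
  | inr j => vert_inputs C0 (val j)
  end.

Lemma carrier_inj : injective carrier.
Proof.
move=> [e|j] [e'|j'] /=.
- by move=> /val_inj ->.
- by move=> h; case/eqP: (edge_neq1 (val j') (valP e)).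
- by move=> h; case/eqP: (edge_neq1 (val j) (valP e')).
- by move=> /finset.set1_inj /val_inj ->.
Qed.

Lemma mem_carrier h s : (h \in carrier s) = (block h == carrier s).
Proof.
case: s => [[e eE]|[j jI]] /=; first by rewrite block_eq_edge.
by rewrite block_eq1// inE.
Qed.

Lemma mem_inputs k s : (k \in inputs s) = (home k == carrier s).
Proof.
case: s => [[e eE]|[j jI]] /=; first by rewrite mem_edge_inputs.
by rewrite mem_vert_inputs.
Qed.

Lemma is_block_carrier (C : {set vertex P}) : is_block C ->
  exists s, C = carrier s.
Proof.
move=> [CE|[j jI ->]]; first by exists (inl (exist _ C CE)).
by exists (inr (exist _ j jI)).
Qed.

Lemma carrier_cover h : exists s, h \in carrier s.
Proof.
have [s sE] := is_block_carrier (block_is_block h).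
by exists s; rewrite mem_carrier sE.
Qed.

Lemma inputs_cover k : exists s, k \in inputs s.
Proof.
have [s sE] := is_block_carrier (home_is_block k).
by exists s; rewrite mem_inputs sE.
Qed.

Lemma carrier_disjoint h s s' : h \in carrier s -> h \in carrier s' -> s = s'.
Proof.
by rewrite !mem_carrier => /eqP hs /eqP hs'; apply: carrier_inj; rewrite -hs.
Qed.

Lemma inputs_disjoint k s s' : k \in inputs s -> k \in inputs s' -> s = s'.
Proof.
by rewrite !mem_inputs => /eqP hs /eqP hs'; apply: carrier_inj; rewrite -hs.
Qed.

(** Isolated blocks store [v] and [x] as scalars, whereas gluing needs vectors indexed by a
    singleton; this passes between the two. *)
Lemma rows_of_set1P (v : 'cV[R]_#|Ju P|) (j : vertex P) (t : R) :
  rows_of [set j]%SET v = const_mx t <-> v j ord0 = t.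
Proof.
split=> [vt|vt].
  have : j \in [set j]%SET by rewrite inE.
  (* The vertex is generalised but the singleton is kept, so the claim ranges over its members. *)
  move: {-2}j; apply/forall_enum_val => i.
  by rewrite -rows_ofE vt mxE.
apply/matrixP => i k; rewrite (ord1 k) rows_ofE mxE -vt.
by have /set1P-> := enum_valP i.
Qed.

Lemma regroup_inj : injective (regroup C0).
Proof.
move=> [[u v] x] [[u' v'] x'] [eqE eqI].
have {}eqE e := f_equal (fun f => f e) eqE.
have {}eqI j := f_equal (fun f => f j) eqI.
congr (_, _, _).
- apply: (rows_of_inj inputs_cover) => -[e|j] /=.
    by have [] := eqE e.
  by have [] := eqI j.
- apply: (rows_of_inj carrier_cover) => -[e|j] /=.
    by have [] := eqE e.
  rewrite [RHS](proj2 (rows_of_set1P v' (val j) _) erefl).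
  by apply/rows_of_set1P; have [_ -> _] := eqI j.
- apply: (rows_of_inj carrier_cover) => -[e|j] /=.
    by have [] := eqE e.
  rewrite [RHS](proj2 (rows_of_set1P x' (val j) _) erefl).
  by apply/rows_of_set1P; have [_ _ ->] := eqI j.
Qed.

(** Prescribed blocks never conflict: [u] is glued along the disjoint [inputs], and [v] and [x]
    along the disjoint [carrier] sets. *)
Lemma regroup_surj (y : block_product_space C0) : exists z, regroup C0 z = y.
Proof.
case: y => ye yj.
pose wu s : 'cV[R]_#|inputs s| :=
  match s with inl e => (ye e).1.1 | inr j => (yj j).1.1 end.
pose wv s : 'cV[R]_#|carrier s| :=
  match s with inl e => (ye e).1.2 | inr j => const_mx (yj j).1.2 end.
pose wx s : 'cV[R]_#|carrier s| :=
  match s with inl e => (ye e).2 | inr j => const_mx (yj j).2 end.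
have [u uE] := rows_of_glue wu inputs_disjoint.
have [v vE] := rows_of_glue wv carrier_disjoint.
have [x xE] := rows_of_glue wx carrier_disjoint.
exists (u, v, x); congr (_, _).
  apply/functional_extensionality_dep => e.
  rewrite (uE (inl e)) (vE (inl e)) (xE (inl e)) /=.
  by case: (ye e) => [[]].
apply/functional_extensionality_dep => j.
have /rows_of_set1P-> := vE (inr j).
have /rows_of_set1P-> := xE (inr j).
rewrite (uE (inr j)) /=.
by case: (yj j) => [[]].
Qed.

Lemma regroup_bij : bijective (regroup C0).
Proof.
(* Choice provides a right inverse, which injectivity makes two-sided. *)
have [g gK] := choice regroup_surj.
by exists g => // z; apply: regroup_inj; rewrite gK.
Qed.

(** * Feasibility block by block *)

Lemma regroup_feasible (z : point P) :
  F P z <-> block_product C0 (regroup C0 z).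
Proof.
case: z => [[u v] x]; split.
  move=> [Uu veq xeq]; split=> [e|j] /=.
    split; first by apply/box_rows_of => k _; exact: Uu.
    move=> i; rewrite !(rows_ofE v, rows_ofE x) preactivation_edge//; last 2 first.
    - exact: (valP e).
    - exact: enum_valP.
    have /complementarity_max0[x0 xv xc] :
      x (enum_val i) ord0 = Num.max (v (enum_val i) ord0) 0.
      by rewrite xeq mxE.
    by split=> //; rewrite veq mxE.
  have /complementarity_max0[x0 xv xc] :
    x (val j) ord0 = Num.max (v (val j) ord0) 0.
    by rewrite xeq mxE.
  split=> //; first by apply/box_rows_of => k _; exact: Uu.
  by rewrite preactivation_vert ?veq ?mxE//; exact: (valP j).
move=> [/= KE KI].
have Uu : U P u.
  move=> k; have [[e|j]] := inputs_cover k; move: k; apply/box_rows_of.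
    by have [] := KE e.
  by have [] := KI j.
(* Some carrier contains [h], and the local constraints of that block determine both its
   pre-activation and its activation. *)
have vx h : v h ord0 = (Wbar P *m u + bbar P) h ord0 /\
            x h ord0 = Num.max (v h ord0) 0.
  have [[e|j]] := carrier_cover h; last first.
    move=> /set1P ->; have [_ x0 xv veq xc] := KI j.
    split; last exact/complementarity_max0.
    by rewrite veq preactivation_vert ?[RHS]mxE//; exact: (valP j).
  move: h; apply/forall_enum_val => i; have [_ /(_ i)] := KE e.
  rewrite !(rows_ofE v, rows_ofE x) => -[x0 xv veq xc].
  split; last exact/complementarity_max0.
  by rewrite veq preactivation_edge ?[RHS]mxE//; [exact: (valP e)|exact: enum_valP].
split=> //; apply/matrixP => h k; rewrite (ord1 k).
  by have [] := vx h.
by rewrite mxE; have [] := vx h.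
Qed.

Lemma regroup_image : (regroup C0 @` F P)%classic = block_product C0.
Proof.
apply/seteqP; split=> [_ [z Fz <-]|y Ky]; first exact/regroup_feasible.
have [z zy] := regroup_surj y; exists z => //.
by apply/regroup_feasible; rewrite zy.
Qed.

(** * Splitting the objective and minimising it *)

Lemma objective_linear gamma (u : 'cV[R]_n0) (v x : 'cV[R]_#|Ju P|) :
  objective P gamma (u, v, x) =
  eta P gamma - \sum_h alpha P h ord0 * x h ord0
              - \sum_k delta P k ord0 * u k ord0.
Proof.
(* Moving the matrix across the product, $c^\top(My)=(M^\top c)^\top y$, produces the coefficients
   [alpha] and [delta]. *)
have dotE m (M : 'M[R]_(n2, m)) (y : 'cV[R]_m) :
  ((c P)^T *m (M *m y)) ord0 ord0 = \sum_k (M^T *m c P) k ord0 * y k ord0.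
  rewrite mulmxA mxE; apply: eq_bigr => k _.
  by rewrite -[M in LHS]trmxK -trmx_mul [in LHS]mxE.
have mxD (X Y : 'M[R]_1) : (X + Y) ord0 ord0 = X ord0 ord0 + Y ord0 ord0.
  by rewrite mxE.
rewrite /objective /eta !mulmxDr !mxD !dotE -/(alpha P) -/(delta P).
ring.
Qed.

(** Sorting vertices by [block] and inputs by [home] sends each linear term to exactly one block,
    the terms of $T_0$ going to [C0]. *)
Lemma objective_blocks gamma (u : 'cV[R]_n0) (v x : 'cV[R]_#|Ju P|) :
  objective P gamma (u, v, x) =
  eta P gamma
  + \sum_(e in edges P)
      Theta_edge C0 e (rows_of (edge_inputs C0 e) u, rows_of e v, rows_of e x)
  + \sum_(j in isolated P)
      Theta_vert C0 j
        (rows_of (vert_inputs C0 j) u, v j ord0, x j ord0).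
Proof.
rewrite objective_linear.
rewrite (sum_by_block (fun h => alpha P h ord0 * x h ord0) block_is_block).
rewrite (sum_by_block (fun k => delta P k ord0 * u k ord0) home_is_block).
have -> : \sum_(e in edges P) Theta_edge C0 e
    (rows_of (edge_inputs C0 e) u, rows_of e v, rows_of e x) =
  - \sum_(e in edges P) \sum_(h | block h == e) alpha P h ord0 * x h ord0
  - \sum_(e in edges P) \sum_(k | home k == e) delta P k ord0 * u k ord0.
  rewrite -opprD -big_split /= -sumrN; apply: eq_bigr => e eE.
  rewrite /input_cost opprD; congr (- _ - _).
    rewrite (sum_rows_of _ (fun h => alpha P h ord0)).
    by apply: eq_bigl => h; rewrite block_eq_edge.
  rewrite (sum_rows_of _ (fun k => delta P k ord0)).
  by apply: eq_bigl => k; rewrite mem_edge_inputs.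
have -> : \sum_(j in isolated P) Theta_vert C0 j
    (rows_of (vert_inputs C0 j) u, v j ord0, x j ord0) =
  - \sum_(j in isolated P) \sum_(h | block h == [set j]%SET)
      alpha P h ord0 * x h ord0
  - \sum_(j in isolated P) \sum_(k | home k == [set j]%SET)
      delta P k ord0 * u k ord0.
  rewrite -opprD -big_split /= -sumrN; apply: eq_bigr => j jI.
  rewrite /input_cost opprD; congr (- _ - _).
    by rewrite (eq_bigl (pred1 j)) ?big_pred1_eq// => h; rewrite block_eq1.
  rewrite (sum_rows_of _ (fun k => delta P k ord0)).
  by apply: eq_bigl => k; rewrite mem_vert_inputs.
ring.
Qed.

Lemma min_objective (U_nonempty : (U P !=set0)%classic) gamma :
  min_attained (F P) (objective P gamma) /\
  min_over (F P) (objective P gamma) =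
    eta P gamma + \sum_(e in edges P) m_edge C0 e
                + \sum_(j in isolated P) m_vert C0 j.
Proof.
have edgeE e := argmin_exists (K_edge_min_attained C0 U_nonempty e).
have vertE j := argmin_exists (K_vert_min_attained C0 U_nonempty j).
(* One minimiser is chosen in every block; surjectivity of [regroup] then glues them into a single
   point. *)
pose y : block_product_space C0 :=
  (fun e => projT1 (cid (edgeE (val e))),
   fun j => projT1 (cid (vertE (val j)))).
have [[[u v] x] zy] := regroup_surj y.
have [ye yj] : (forall e, (regroup C0 (u, v, x)).1 e = y.1 e) /\
               (forall j, (regroup C0 (u, v, x)).2 j = y.2 j) by rewrite zy.
have Fz : F P (u, v, x).
  apply/regroup_feasible; split=> [e|j]; rewrite ?ye ?yj /=.
    by have [] := projT2 (cid (edgeE (val e))).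
  by have [] := projT2 (cid (vertE (val j))).
have objz : objective P gamma (u, v, x) =
    eta P gamma + \sum_(e in edges P) m_edge C0 e
                + \sum_(j in isolated P) m_vert C0 j.
  rewrite objective_blocks; congr (_ + _ + _).
    apply: eq_bigr => e eE; rewrite [X in Theta_edge C0 e X](ye (exist _ e eE)).
    by have [] := projT2 (cid (edgeE e)).
  apply: eq_bigr => j jI; rewrite [X in Theta_vert C0 j X](yj (exist _ j jI)).
  by have [] := projT2 (cid (vertE j)).
rewrite -objz; apply: min_attained_argmin => //.
(* Any feasible competitor restricts to feasible local points, each costing at least its local
   minimum. *)
move=> [[u' v'] x'] /regroup_feasible[KE KI].
rewrite objz objective_blocks; apply: lerD; first apply: lerD => //.
  apply: ler_sum => e eE; apply: min_over_le; first exact: K_edge_min_attained.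
  exact: (KE (exist _ e eE)).
apply: ler_sum => j jI; apply: min_over_le; first exact: K_vert_min_attained.
exact: (KI (exist _ j jI)).
Qed.

End Decomposition.

Theorem proposition4p2 (R : realType) (n0 n1 n2 : nat)
  (P : problem R n0 n1 n2)
  (U_nonempty : (U P !=set0)%classic)
  (bounds : valid_preactivation_bounds P)
  (Ju_nonempty : Ju P != finset.set0)
  (matching : is_matching P)
  (C0 : {set vertex P})
  (C0_component : T P finset.set0 != finset.set0 -> C0 \in components P) :
  [/\ bijective (regroup C0),
      (regroup C0 @` F P)%classic = block_product C0,
      forall e, e \in edges P ->
        min_attained (K_edge C0 e) (Theta_edge C0 e),
      forall j, j \in isolated P ->
        min_attained (K_vert C0 j) (Theta_vert C0 j)
    & forall gamma : R,
        min_attained (F P) (objective P gamma) /\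
        min_over (F P) (objective P gamma) =
          eta P gamma + \sum_(e in edges P) m_edge C0 e
                      + \sum_(j in isolated P) m_vert C0 j].
Proof.
split.
- exact: regroup_bij.
- exact: regroup_image.
- by move=> e _; exact: K_edge_min_attained.
- by move=> j _; exact: K_vert_min_attained.
- by move=> gamma; exact: min_objective.
Qed.
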